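(* Let $T$ be a contraction on a Hilbert space $\mathcal H$. Let $V_{m_1}$, acting on a Hilbert space $\mathcal K_{m_1}$, be a minimal isometric dilation of $T$ corresponding to an isometry $\mathcal E_{m_1}:\mathcal H\to\mathcal K_{m_1}$, and let $V_{m_2}$, acting on a Hilbert space $\mathcal K_{m_2}$, be any other minimal isometric dilation of $T$ corresponding to an isometry $\mathcal E_{m_2}:\mathcal H\to\mathcal K_{m_2}$. Then there exists a unique unitary $\Xi_u\in\mathcal B(\mathcal K_{m_2},\mathcal K_{m_1})$ such that $$\mathcal E_{m_1}=\Xi_u\,\mathcal E_{m_2}\quad\text{and}\quad \Xi_uV_{m_2}^*=V_{m_1}^*\Xi_u.$$
   Context: An isometry $V$ on $\mathcal K$ is an isometric dilation of a contraction $T$ on $\mathcal H$ corresponding to an isometry $\mathcal E:\mathcal H\to\mathcal K$ if $\mathcal ET^*=V^*\mathcal E$. It is minimal if $\mathcal K=\overline{\operatorname{span}}\{V^m(\mathcal E\mathcal H):m\ge0\}$. *)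

(* Defs.v *)
From HB Require Import structures.
From mathcomp Require Import all_boot all_order all_algebra.
From mathcomp Require Import sesquilinear complex ring lra.
From mathcomp Require Import mathcomp_extra boolp classical_sets functions.
From mathcomp Require Import reals interval_inference topology normedtype.
From mathcomp Require Import sequences.

Set Implicit Arguments.
Unset Strict Implicit.
Unset Printing Implicit Defensive.

Import Order.TTheory GRing.Theory Num.Theory.
Import numFieldNormedType.Exports.

Local Open Scope classical_set_scope.
Local Open Scope ring_scope.
Local Open Scope complex_scope.

(* Complex Hilbert spaces: the norm takes its values in R[i], and [inner] is
   linear in its first argument and conjugate-linear in its second. *)
HB.mixin Record isHilbert (R : realType) H & CompleteNormedModule R[i] H := {
  inner : {dot H for @Num.conj R[i]} ;
  inner_normE : forall x : H, inner x x = `|x| ^+ 2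
}.

#[short(type="hilbertType")]
HB.structure Definition Hilbert (R : realType) :=
  {H of CompleteNormedModule R[i] H & isHilbert R H}.

(* For linear maps, continuity is boundedness ([linear_bounded_continuous]). *)
#[short(type="bounded_operator")]
HB.structure Definition BoundedOperator (R : realType) (H K : hilbertType R) :=
  {f of @GRing.Linear R[i] H K *:%R f & @isContinuous H K f}.

Notation "''B' ( H , K )" := (@bounded_operator _ H K)
  (at level 8, format "''B' ( H ,  K )") : type_scope.

Lemma bounded_operator_ext (R : realType) (H K : hilbertType R)
    (f g : 'B(H, K)) : f =1 g -> f = g.
Proof.
case: f g => f [[+] [+] [+]] [g [[+] [+] [+]]] /= /funext e.
rewrite -{}e => a b c a' b' c'.
by rewrite (Prop_irrelevance a a') (Prop_irrelevance b b')
  (Prop_irrelevance c c').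
Qed.

Section Riesz.
Variables (R : realType) (H : hilbertType R).
Implicit Types x y z : H.
Local Notation r x := (complex.Re `|x|).
Local Notation B x y := (complex.Re (inner x y)).

Lemma hnorm_ReE x : `|x| = (r x)%:C.
Proof. by rewrite RRe_real ?normr_real. Qed.

Lemma Re_hnorm_ge0 x : 0 <= r x.
Proof. by rewrite -lecR -hnorm_ReE normr_ge0. Qed.

Lemma Re_hnormD x y : r (x + y) <= r x + r y.
Proof. by rewrite -lecR rmorphD /= -!hnorm_ReE ler_normD. Qed.

Lemma Re_hnormN x : r (- x) = r x.
Proof. by rewrite normrN. Qed.

Lemma Re_innerxx x : B x x = r x ^+ 2.
Proof. by rewrite inner_normE hnorm_ReE -rmorphXn. Qed.

Lemma innerC x y : inner x y = (inner y x)^*.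
Proof. by rewrite (hermC inner) expr0 mul1r. Qed.

Lemma Re_innerC x y : B x y = B y x.
Proof. by rewrite innerC; case: (inner y x). Qed.

Lemma Re_innerDl x y z : B (x + y) z = B x z + B y z.
Proof. by rewrite linearDl raddfD. Qed.

Lemma innerZl (a : R[i]) x y : inner (a *: x) y = a * inner x y.
Proof. exact: linearZl_LR. Qed.

Lemma Re_innerZl (a : R) x y : B (a%:C *: x) y = a * B x y.
Proof.
rewrite innerZl; case: (inner x y) => u v /=.
by rewrite mul0r subr0.
Qed.

Lemma Re_innerNl x y : B (- x) y = - B x y.
Proof. by rewrite linearNl raddfN. Qed.

Lemma hilbert_seq_complete (x : nat -> H) :
  (forall e : R, 0 < e -> exists N, forall n, (N <= n)%N -> r (x N - x n) < e) ->
  exists z, forall e : R, 0 < e -> exists N, forall n, (N <= n)%N ->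
     r (z - x n) < e.
Proof.
move=> hC.
have : cvg (x @ \oo).
  apply/cauchy_cvgP; apply: cauchy_exP => e e0.
  have er : e = (complex.Re e)%:C by rewrite RRe_real ?gtr0_real.
  have [|N hN] := hC (complex.Re e); first by rewrite -ltcR -er.
  exists (x N); exists N => // n /= Nn.
  by rewrite -ball_normE /= hnorm_ReE er ltcR hN.
move=> /cvg_ex[z xz]; exists z => e e0.
have e0' : 0 < e%:C by rewrite ltcR.
have /cvgrPdist_lt /(_ _ e0') [N _ hN] := xz.
by exists N => n Nn; rewrite -ltcR -hnorm_ReE hN.
Qed.

(* A bounded real-linear functional p is represented by the minimiser of
   |x|^2 - 2 p x, which exists by the parallelogram law and completeness. *)
Lemma Re_riesz (p : H -> R) (M : R) :
  (forall x y, p (x + y) = p x + p y) ->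
  (forall (a : R) x, p (a%:C *: x) = a * p x) ->
  (forall x, `|p x| <= M * r x) ->
  exists z, forall x, p x = B x z.
Proof.
move=> pD pZ pM.
pose J x := r x ^+ 2 - 2 * p x.
have M0 : exists2 M', 0 <= M' & forall x, `|p x| <= M' * r x.
  exists `|M| => // x; apply: le_trans (pM x) _.
  by rewrite ler_wpM2r ?Re_hnorm_ge0// ler_norm.
case: M0 => {pM}M M0 pM.
have Jlb x : - M ^+ 2 <= J x.
  have := pM x; rewrite ler_norml /J => /andP[_ ?].
  have := sqr_ge0 (r x - M); nra.
pose m := inf (range J).
have hinf : has_inf (range J).
  by split; [exists (J 0), 0|exists (- M ^+ 2) => _ [x _ <-]].
have mJ x : m <= J x by apply: ge_inf; [case: hinf|exists x].
have hx n : exists x, J x < m + n.+1%:R^-1.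
  have [|_ [x _ <-] ?] := @inf_adherent _ (range J) n.+1%:R^-1 _ hinf.
    by rewrite invr_gt0.
  by exists x.
have {hx}[x hx] := choice hx.
have par u v : r (u - v) ^+ 2 <= 2 * (J u - m) + 2 * (J v - m).
  have := mJ ((2^-1)%:C *: (u + v)).
  rewrite /J pZ pD -!Re_innerxx !(Re_innerZl, Re_innerDl, Re_innerC _ (_%:C *: _), Re_innerC _ (_ + _), Re_innerNl, Re_innerC _ (- _)) (Re_innerC v u).
  lra.
have eps_n (e : R) : 0 < e -> exists N, forall n, (N <= n)%N -> n.+1%:R^-1 < e.
  move=> /posnumP[{}e]; have [N _ hN] := near_infty_natSinv_lt e.
  by exists N => n /hN.
have [|z zx] := @hilbert_seq_complete x.
  move=> e e0; have [|N hN] := eps_n (e ^+ 2 / 4).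
    by rewrite divr_gt0// exprn_gt0.
  exists N => n Nn.
  rewrite -(ltr_pXn2r (n := 2))// ?nnegrE ?Re_hnorm_ge0 ?(ltW e0)//.
  apply: le_lt_trans (par _ _) _.
  have := hx N; have := hx n; have := hN _ Nn; have := hN _ (leqnn N).
  move: (J _) (J _) (e ^+ 2) (N.+1%:R^-1) (n.+1%:R^-1) => a b c d f; lra.
have Jz : J z <= m.
  apply/ler_addgt0Pr => e e0.
  pose c := 2 * r z + 3 + 2 * M.
  have c0 : 0 < c by have := Re_hnorm_ge0 z; rewrite /c; lra.
  have [|N1 h1] := zx (Num.min 1 (e / 2 / c)).
    by rewrite lt_min ltr01 !divr_gt0.
  have [|N2 h2] := eps_n (e / 2); first by rewrite divr_gt0.
  pose n := maxn N1 N2.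
  have := h1 n (leq_maxl _ _); have {h2} := h2 n (leq_maxr _ _).
  rewrite lt_min [X in _ && X]ltr_pdivlMr// => h2 /andP[d1 dc].
  have := hx n; rewrite /J.
  have -> : p z = p (x n) + p (z - x n) by rewrite -pD addrC subrK.
  have h3 : r z <= r (x n) + r (z - x n).
    by rewrite (le_trans _ (Re_hnormD _ _))// addrC subrK.
  have h4 : r (x n) <= r z + r (z - x n).
    by rewrite -(Re_hnormN (z - x n)) (le_trans _ (Re_hnormD _ _))// opprB addrC subrK.
  have := pM (z - x n); rewrite ler_norml => /andP[h5 _].
  have := Re_hnorm_ge0 (z - x n); have := Re_hnorm_ge0 z; have := Re_hnorm_ge0 (x n).
  move: h2 d1 dc h3 h4 h5; rewrite /c.
  move: (r (z - x n)) (r z) (r (x n)) (p (x n)) (p (z - x n)) (n.+1%:R^-1).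
  move=> d a b p1 p2 f fe d1 dc ab ba p2M b0 a0 d0 Jx.
  have h6 : a ^+ 2 <= (b + d) ^+ 2 by rewrite ler_pXn2r// nnegrE; lra.
  have h7 : b * d <= (a + d) * d by rewrite ler_wpM2r.
  have h8 : d * d <= d by rewrite ler_piMr// ltW.
  nra.
exists z => v.
have key (t : R) : 0 <= t ^+ 2 * r v ^+ 2 + 2 * t * (B v z - p v).
  have := le_trans Jz (mJ (z + t%:C *: v)).
  rewrite /J pD pZ -!Re_innerxx !(Re_innerZl, Re_innerDl, Re_innerC _ (_%:C *: _), Re_innerC _ (_ + _)) (Re_innerC v z).
  lra.
apply/eqP; rewrite eq_sym -subr_eq0; apply/eqP.
move: key; move: (B v z - p v) (r v ^+ 2) (sqr_ge0 (r v)) => b a a0 key.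
have := key (- b / (a + 1)).
have a1 : 0 < a + 1 by lra.
have -> : (- b / (a + 1)) ^+ 2 * a + 2 * (- b / (a + 1)) * b
   = - (b ^+ 2 * (a + 2) / (a + 1) ^+ 2) by field; lra.
rewrite oppr_ge0 pmulr_lle0 ?invr_gt0 ?exprn_gt0// pmulr_lle0; last by lra.
by move=> h; apply/eqP; rewrite -sqrf_eq0 eq_le h sqr_ge0.
Qed.

Lemma Re_inner_CauchySchwarz x y : `|B x y| <= r x * r y.
Proof.
rewrite -(ler_pXn2r (n := 2)) ?nnegrE ?mulr_ge0 ?Re_hnorm_ge0//.
rewrite real_normK ?num_real// exprMn -!Re_innerxx.
have [->|y0] := eqVneq y 0.
  by rewrite !raddf0 expr0n /= mulr0.
have Byy : 0 < B y y.
  by rewrite -ltcR RRe_real ?gtr0_real// neq0_dnorm_gt0.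
rewrite -subr_ge0 -(pmulr_lge0 _ Byy).
have := sqr_ge0 (r ((B y y)%:C *: x - (B x y)%:C *: y)).
rewrite -Re_innerxx !(Re_innerZl, Re_innerDl, Re_innerC _ (_%:C *: _), Re_innerC _ (_ + _), Re_innerNl, Re_innerC _ (- _)).
rewrite (Re_innerC y x); move: (B x x) (B x y) (B y y) => a b c; lra.
Qed.

Lemma inner_ext x y : (forall z, inner z x = inner z y) -> x = y.
Proof.
move=> h; have h0 : inner (x - y) (x - y) = 0 by rewrite raddfB /= h subrr.
apply/eqP; rewrite -subr_eq0; apply/negP => /negP.
by move=> /(neq0_dnorm_gt0 (s := inner)); rewrite h0 ltxx.
Qed.
End Riesz.

Section Adjoint.
Variables (R : realType) (H K : hilbertType R).
Local Notation r x := (complex.Re `|x|).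
Local Notation B x y := (complex.Re (inner x y)).

Lemma bop_bound (T : 'B(H, K)) :
  exists2 M : R, 0 <= M & forall x, r (T x) <= M * r x.
Proof.
have /linear_bounded_continuous/linear_boundedP := @cts_fun _ _ T.
move=> /pinfty_ex_gt0[M M0 hM].
have eM : M = (complex.Re M)%:C by rewrite RRe_real ?gtr0_real.
exists (complex.Re M); first by rewrite -lecR -eM ltW.
by move=> x; rewrite -lecR rmorphM /= -eM -!hnorm_ReE hM.
Qed.

Lemma adjoint_exists (T : 'B(H, K)) :
  exists S : 'B(K, H), forall x y, inner (T x) y = inner x (S y).
Proof.
have [M M0 hM] := bop_bound T.
have TB x y : `|B (T x) y| <= M * r y * r x.
  apply: le_trans (Re_inner_CauchySchwarz _ _) _.
  by rewrite mulrAC ler_wpM2r ?Re_hnorm_ge0.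
have /choice[S hS] : forall y, exists z, forall x, inner (T x) y = inner x z.
  move=> y.
  have [|||z hz] := @Re_riesz _ _ (fun x => B (T x) y) (M * r y).
  - by move=> u v; rewrite linearD Re_innerDl.
  - by move=> a u; rewrite linearZ Re_innerZl.
  - by move=> u; exact: TB.
  exists z => x.
  have := hz x; have := hz ('i *: x); rewrite linearZ /= !innerZl.
  case: (inner (T x) y) (inner x z) => [a b] [c d] /=.
  by rewrite !mul0r !mul1r !sub0r => /oppr_inj -> ->.
have Slin : linear S.
  move=> a u v; apply: inner_ext => x.
  by rewrite -hS !linearDr !linearZr_LR /= !hS.
pose L := HB.pack_for {linear K -> H} S (GRing.isLinear.Build _ _ _ _ S Slin).
have Scont : continuous S.
  apply: (@bounded_linear_continuous _ _ _ L); apply/linear_boundedP.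
  near=> e => y.
  have : r (S y) <= M * r y.
    have [->|Sy0] := eqVneq (r (S y)) 0; first by rewrite mulr_ge0 ?Re_hnorm_ge0.
    have Sy : 0 < r (S y) by rewrite lt_def Sy0 Re_hnorm_ge0.
    rewrite -(ler_pM2r Sy) -expr2 -Re_innerxx -hS.
    exact: le_trans (ler_norm _) (TB _ _).
  rewrite -lecR rmorphM /= -!hnorm_ReE => /le_trans; apply.
  by rewrite ler_wpM2r//; near: e; apply: nbhs_pinfty_ge; rewrite ger0_real ?lecR.
exists (HB.pack_for 'B(K, H) S (GRing.isLinear.Build _ _ _ _ S Slin)
  (isContinuous.Build _ _ S Scont)).
by move=> x y; exact: hS.
Unshelve. all: by end_near. Qed.
End Adjoint.

Definition adjoint (R : realType) (H K : hilbertType R) (T : 'B(H, K)) :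
  'B(K, H) := projT1 (cid (adjoint_exists T)).

Lemma adjointP (R : realType) (H K : hilbertType R) (T : 'B(H, K)) x y :
  inner (T x) y = inner x (adjoint T y).
Proof. exact: (projT2 (cid (adjoint_exists T))). Qed.

Definition contractive (R : realType) (H K : hilbertType R) (T : 'B(H, K)) :=
  forall x, `|T x| <= `|x|.

Definition isometric (R : realType) (H K : hilbertType R) (V : 'B(H, K)) :=
  forall x, `|V x| = `|x|.

Definition unitary (R : realType) (H K : hilbertType R) (U : 'B(H, K)) :=
  adjoint U \o U = id /\ U \o adjoint U = id.

Definition linear_span (C : nzRingType) (M : lmodType C) (A : set M) : set M :=
  [set x | exists n (a : 'I_n -> C) (v : 'I_n -> M),
    (forall i, A (v i)) /\ x = \sum_(i < n) a i *: v i].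

Definition isometric_dilation (R : realType) (H K : hilbertType R)
    (T : 'B(H, H)) (V : 'B(K, K)) (E : 'B(H, K)) :=
  [/\ isometric V, isometric E & E \o adjoint T = adjoint V \o E].

Definition minimal_isometric_dilation (R : realType) (H K : hilbertType R)
    (T : 'B(H, H)) (V : 'B(K, K)) (E : 'B(H, K)) :=
  isometric_dilation T V E /\
  closure (linear_span [set x | exists (m : nat) (h : H), x = iter m V (E h)])
    = [set: K].

(* Main.v *)
Require Import Defs.
From HB Require Import structures.
From mathcomp Require Import all_boot all_order all_algebra.
From mathcomp Require Import sesquilinear complex lra.
From mathcomp Require Import boolp classical_sets functions.
From mathcomp Require Import filter reals topology normedtype.

(** A minimal isometric dilation is determined by the inner products of the
    vectors [V^m E h], which span a dense subspace, and these inner products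
    depend on [T] alone: cancelling common powers of the isometry [V] leaves
    [<V^l E h, E k> = <E h, V*^l E k> = <E h, E T*^l k> = <h, T*^l k>]
    ([inner_dilation_orbit]).  So the orbits of two minimal dilations of [T] are
    total families with the same Gram matrix.

    Two total families [u], [v] with the same Gram matrix are related by a
    unitary [U] ([gram_unitary]).  The image of [x] is characterised without
    mentioning linear combinations, as the vector [y] such that
    [<v_i, y> = <u_i, x>] for all [i].  Totality of [v] gives uniqueness, hence
    linearity; existence is an extension by density: combinations of the [u_i]
    that approach [x] are sent to combinations of the [v_i] with the same
    mutual distances, which converge by completeness ([gram_transport]).

    The same characterisation yields the rest.  Since
    [<V1 v, Xi x> = <v, V1* (Xi x)>], the operator [V1* o Xi] tested on the
    orbit of [V1] is [Xi] tested on the shifted orbit; this gives the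
    intertwining relation.  Conversely, any isometry that carries [E2] to [E1]
    and intertwines the adjoints satisfies the characterisation, by induction
    on the power of [V1]; this gives uniqueness. *)

Set Implicit Arguments.
Unset Strict Implicit.
Unset Printing Implicit Defensive.

Import Order.TTheory GRing.Theory Num.Theory.
Import numFieldNormedType.Exports.

Local Open Scope classical_set_scope.
Local Open Scope ring_scope.

(** The bound on the real part suffices once the first vector is multiplied by
    the conjugate of [inner x y], which makes the inner product real. *)
Lemma inner_CauchySchwarz (R : realType) (H : hilbertType R) (x y : H) :
  `|inner x y| <= `|x| * `|y|.
Proof.
have [->|c0] := eqVneq (inner x y) 0; first by rewrite normr0 mulr_ge0.
have := Re_inner_CauchySchwarz ((inner x y)^* *: x) y.
rewrite innerZl mulrC -normCK => /(le_trans (ler_norm _)).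
have c2 : `|inner x y| ^+ 2 \is Num.real by rewrite rpredX ?normr_real.
rewrite -lecR RRe_real//.
(* An opaque name for the square keeps the simplification below from unfolding
   the norm of a complex number. *)
have [d dE] : exists d, `|inner x y| ^+ 2 = d by eexists.
rewrite dE rmorphM /= -!hnorm_ReE -{}dE normrZ norm_conjC expr2.
by rewrite -mulrA ler_pM2l ?normr_gt0.
Qed.

Lemma cvg_inner (R : realType) (H : hilbertType R) (S : Type)
    (F : set_system S) (FF : Filter F) (f : S -> H) (a x : H) :
  f @ F --> x -> inner a (f s) @[s --> F] --> inner a x.
Proof.
move=> fx; apply/cvgrPdist_lt => e e0.
have a1 : 0 < `|a| + 1 by rewrite ltr_wpDl.
have /cvgrPdist_lt /(_ (e / (`|a| + 1))) := fx.
rewrite divr_gt0// => /(_ isT); apply: filterS => s /=.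
rewrite ltr_pdivlMr// => h; rewrite -linearBr.
apply: le_lt_trans (inner_CauchySchwarz _ _) _; apply: le_lt_trans h.
by rewrite mulrC ler_wpM2l// lerDl.
Qed.

(** Polarization: the squared norms of [x + y] and [x + 'i y] determine the real
    and the imaginary part of [inner x y]. *)
Lemma isometric_inner (R : realType) (H K : hilbertType R) (V : 'B(H, K)) :
  isometric V -> forall x y, inner (V x) (V y) = inner x y.
Proof.
move=> Viso x y.
have VE z : inner (V z) (V z) = inner z z by rewrite !inner_normE Viso.
have := VE (x + 'i%C *: y); have := VE (x + y).
rewrite !linearD /= !linearDl !linearZ /= !innerZl !VE.
case: (inner (V x) (V y)) (inner (V y) (V x)) (inner x y) (inner y x)
  (inner x x) (inner y y) => [a a'] [b b'] [c c'] [d d'] [e e'] [f f'] /=.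
by case=> ? ? [? ?]; congr Complex; lra.
Qed.

Lemma isometric_unitary (R : realType) (H K : hilbertType R) (U : 'B(H, K)) :
  isometric U -> (forall y, exists x, U x = y) -> unitary U.
Proof.
move=> Uiso Usurj.
have UK x : adjoint U (U x) = x.
  by apply: inner_ext => z; rewrite -adjointP isometric_inner.
split; apply: funext => // y /=.
by have [x <-] := Usurj y; rewrite UK.
Qed.

Lemma bounded_operator_of_isometry (R : realType) (H K : hilbertType R) (f : H -> K) :
  linear f -> (forall x, `|f x| = `|x|) ->
  exists2 U : 'B(H, K), isometric U & U =1 f.
Proof.
move=> flin fN.
pose L := HB.pack_for {linear H -> K} f (GRing.isLinear.Build _ _ _ _ f flin).
have fcont : continuous f.
  apply: (@bounded_linear_continuous _ _ _ L); apply/linear_boundedP.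
  by near=> e => x; rewrite fN ler_peMl.
by exists (HB.pack_for 'B(H, K) f (GRing.isLinear.Build _ _ _ _ f flin)
  (isContinuous.Build _ _ f fcont)).
Unshelve. all: by end_near. Qed.

Section Families.
Variables (R : realType) (I : Type).

Definition lincomb (H : hilbertType R) (u : I -> H) (s : seq (R[i] * I)) : H :=
  \sum_(p <- s) p.1 *: u p.2.

Definition total (H : hilbertType R) (u : I -> H) :=
  closure (range (lincomb u)) = [set: H].

Lemma lincombB (H : hilbertType R) (u : I -> H) s t :
  lincomb u s - lincomb u t = lincomb u (s ++ [seq (- p.1, p.2) | p <- t]).
Proof.
rewrite /lincomb big_cat big_map -sumrN; congr (_ + _).
by apply: eq_bigr => p _; rewrite scaleNr.
Qed.

Lemma linear_span_range (H : hilbertType R) (u : I -> H) :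
  linear_span (range u) `<=` range (lincomb u).
Proof.
move=> _ [n [a [v [vu ->]]]].
have /choice[j jv] k : exists i, u i = v k by have [i _ <-] := vu k; exists i.
exists [seq (a k, j k) | k <- enum 'I_n] => //.
rewrite /lincomb big_map big_enum; apply: eq_bigr => k _ /=.
by rewrite jv.
Qed.

(** If [d] is orthogonal to the family and not zero, then every combination [w]
    satisfies [|d|^2 = <d - w, d> <= |d - w| |d|], so none lies within [|d|] of
    [d]. *)
Lemma total_inner_ext (H : hilbertType R) (u : I -> H) (x y : H) :
  total u -> (forall i, inner (u i) x = inner (u i) y) -> x = y.
Proof.
move=> utot uxy; apply/eqP; rewrite -subr_eq0; set d := x - y.
have ud s : inner (lincomb u s) d = 0.
  rewrite linear_sumlz big1//= => p _.
  by rewrite innerZl raddfB /= uxy subrr mulr0.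
apply: contraT; rewrite -normr_gt0 => d0.
have : closure (range (lincomb u)) d by rewrite utot.
move=> /(_ (ball d `|d|)) [|_ [[s _ <-]]]; first exact: nbhsx_ballx.
rewrite -ball_normE /= => ds.
have := inner_CauchySchwarz (d - lincomb u s) d.
rewrite linearBl /= ud subr0 inner_normE normrX normr_id expr2 ler_pM2r//.
by move=> /le_lt_trans/(_ ds); rewrite ltxx.
Qed.

Variables (H K : hilbertType R) (u : I -> H) (v : I -> K).
Hypothesis gram : forall i j, inner (u i) (u j) = inner (v i) (v j).
Hypothesis utot : total u.

Lemma inner_lincomb i s : inner (u i) (lincomb u s) = inner (v i) (lincomb v s).
Proof.
rewrite !linear_sumr; apply: eq_bigr => p _.
by rewrite !linearZr_LR /= gram.
Qed.

Lemma norm_lincomb s : `|lincomb u s| = `|lincomb v s|.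
Proof.
apply/eqP; rewrite -(eqrXn2 (ltn0Sn 1))// -!inner_normE; apply/eqP.
rewrite !linear_sumlz; apply: eq_bigr => p _; rewrite /= !innerZl; congr (_ * _).
exact: inner_lincomb.
Qed.

(** The extension by density.  Coefficient lists are filtered by how close their
    [u]-combination is to [x]; along this filter the [v]-combinations are Cauchy,
    because equal Gram matrices give equal distances.  Working with this filter
    rather than a sequence dispenses with choosing approximants. *)
Lemma gram_transport (x : H) :
  exists2 y : K, `|y| = `|x| & forall i, inner (v i) y = inner (u i) x.
Proof.
pose F : set_system (seq (R[i] * I)) :=
  filter_from (nbhs x) (preimage (lincomb u)).
have FF : ProperFilter F.
  apply: filter_from_proper => [|A xA].
    apply: filter_from_filter => [|A B xA xB]; first by exists setT; apply: filterT.
    by exists (A `&` B); first exact: filterI.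
  have : closure (range (lincomb u)) x by rewrite utot.
  by move=> /(_ A xA) [_ [[s _ <-]]]; exists s.
have ux : lincomb u @ F --> x by move=> A xA; exists A.
have /cvg_ex[y vy] : cvg (lincomb v @ F).
  apply/cauchy_cvgP; apply: cauchy_exP => e e0.
  have xe : nbhs x (ball x (e / 2)) by apply: nbhsx_ballx; rewrite divr_gt0.
  have [s0 xs0] := @filter_ex _ F _ _ (ux _ xe).
  exists (lincomb v s0); exists (ball x (e / 2)) => // s xs.
  have := ball_splitr xs0 xs; rewrite /= -!ball_normE /=.
  by rewrite !lincombB norm_lincomb.
exists y => [|i].
  have uN : `|lincomb u s| @[s --> F] --> `|x| by exact: cvg_norm.
  have vN : `|lincomb v s| @[s --> F] --> `|y| by exact: cvg_norm.
  move: vN; under eq_fun do rewrite -norm_lincomb.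
  by move=> /norm_cvg_unique; apply.
have uI : inner (u i) (lincomb u s) @[s --> F] --> inner (u i) x.
  exact: cvg_inner.
have vI : inner (v i) (lincomb v s) @[s --> F] --> inner (v i) y.
  exact: cvg_inner.
move: vI; under eq_fun do rewrite -inner_lincomb.
by move=> /norm_cvg_unique; apply.
Qed.

End Families.

(** The equation [inner (v i) (U x) = inner (u i) x] says that [U] sends [u i] to
    [v i], in a form that determines [U x] for every [x].  Surjectivity is
    the transport lemma with the two families exchanged. *)
Lemma gram_unitary (R : realType) (I : Type) (H K : hilbertType R)
    (u : I -> H) (v : I -> K) :
  (forall i j, inner (u i) (u j) = inner (v i) (v j)) -> total u -> total v ->
  exists2 U : 'B(H, K), unitary U &
    forall i x, inner (v i) (U x) = inner (u i) x.
Proof.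
move=> gram utot vtot.
have /choice[f fP] x : exists y,
    `|y| = `|x| /\ forall i, inner (v i) y = inner (u i) x.
  by have [y] := gram_transport gram utot x; exists y.
have flin : linear f.
  move=> a x y; apply: (total_inner_ext vtot) => i.
  by rewrite (fP _).2 !linearDr !linearZr_LR /= !(fP _).2.
have [U Uiso Uf] := bounded_operator_of_isometry flin (fun x => (fP x).1).
have Uv i x : inner (v i) (U x) = inner (u i) x by rewrite Uf (fP x).2.
exists U => //; apply: isometric_unitary => // y.
have [x _ xy] := gram_transport (fun i j => esym (gram i j)) vtot y.
by exists x; apply: (total_inner_ext vtot) => i; rewrite Uv xy.
Qed.

Definition orbit (R : realType) (H K : hilbertType R) (V : 'B(K, K))
  (E : 'B(H, K)) (p : nat * H) : K := iter p.1 V (E p.2).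

Lemma total_orbit (R : realType) (H K : hilbertType R) (T : 'B(H, H))
    (V : 'B(K, K)) (E : 'B(H, K)) :
  minimal_isometric_dilation T V E -> total (orbit V E).
Proof.
move=> [_ Vmin]; rewrite /total -subTset -Vmin; apply: closureS.
move=> x xV; apply: linear_span_range.
by case: xV => n [a [w [wV xE]]]; exists n, a, w; split=> // i;
  have [m [h ->]] := wV i; exists (m, h).
Qed.

(** Comparing two dilations avoids computing the common value
    [<h, T*^l k>]: each step that lowers a power is valid on both sides. *)
Lemma inner_dilation_orbit (R : realType) (H K K' : hilbertType R)
    (T : 'B(H, H)) (V : 'B(K, K)) (E : 'B(H, K))
    (V' : 'B(K', K')) (E' : 'B(H, K')) :
  isometric_dilation T V E -> isometric_dilation T V' E' ->
  forall p q, inner (orbit V E p) (orbit V E q) =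
              inner (orbit V' E' p) (orbit V' E' q).
Proof.
move=> [Viso Eiso EV] [V'iso E'iso EV'] [m h] [n k]; rewrite /orbit /=.
have pull (L : hilbertType R) (W : 'B(L, L)) (G : 'B(H, L)) :
    G \o adjoint T = adjoint W \o G ->
    forall x l, inner (W x) (G l) = inner x (G (adjoint T l)).
  by move=> GW x l; rewrite adjointP -[adjoint W _]/((adjoint W \o G) l) -GW.
(* A power of the dilation against a vector of the base space moves across as a
   power of [T*], which is common to the two dilations. *)
have key l g j : inner (iter l V (E g)) (E j) = inner (iter l V' (E' g)) (E' j).
  elim: l j => [|l IH] j /=; first by rewrite !isometric_inner.
  by rewrite (pull _ _ _ EV) (pull _ _ _ EV').
(* Cancel common powers until one of the exponents is zero. *)
elim: m n => [|m IH] [|n]; [exact: key| |exact: key|].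
  by rewrite innerC [RHS]innerC; congr (_^*); exact: (key n.+1).
by rewrite /= !isometric_inner.
Qed.

Theorem corollary4p2 (R : realType) (H Km1 Km2 : hilbertType R)
    (T : 'B(H, H))
    (Vm1 : 'B(Km1, Km1)) (Em1 : 'B(H, Km1))
    (Vm2 : 'B(Km2, Km2)) (Em2 : 'B(H, Km2)) :
  contractive T ->
  minimal_isometric_dilation T Vm1 Em1 ->
  minimal_isometric_dilation T Vm2 Em2 ->
  exists! Xi : 'B(Km2, Km1),
    [/\ unitary Xi,
        Em1 = Xi \o Em2 :> (H -> Km1) &
        Xi \o adjoint Vm2 = adjoint Vm1 \o Xi].
Proof.
move=> _ min1 min2; pose v := orbit Vm1 Em1; pose u := orbit Vm2 Em2.
have vtot : total v := total_orbit min1.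
have [Xi Xiu Xiv] := gram_unitary (inner_dilation_orbit min2.1 min1.1)
  (total_orbit min2) vtot.
exists Xi; split.
  split=> //; apply: funext => z /=; apply: (total_inner_ext vtot) => p.
    by rewrite Xiv (inner_dilation_orbit min2.1 min1.1 p (0, z)).
  rewrite Xiv -!adjointP.
  (* Both sides are tested against the next vector of the orbit. *)
  exact: esym (Xiv (p.1.+1, p.2) z).
move=> Xi' [[Xi'K _] Xi'E Xi'V].
(* It suffices that [Xi'] satisfies the equations that determine [Xi]. *)
apply: bounded_operator_ext => x; apply: (total_inner_ext vtot) => p.
rewrite Xiv; case: p => m h.
have Xi'inner y z : inner (Xi' y) (Xi' z) = inner y z.
  by rewrite adjointP -[adjoint _ _]/((adjoint Xi' \o Xi') z) Xi'K.
elim: m x => [|m IH] x.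
  by rewrite /v /orbit /= Xi'E /= Xi'inner.
rewrite /v /orbit /= !adjointP -[adjoint Vm1 _]/((adjoint Vm1 \o Xi') x).
by rewrite -Xi'V /=; exact: IH.
Qed.
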